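(* Let $G$ be an infinite pro-(finite nilpotent) group which has a compactly generated topologically simple envelope. Then $G$ is a pro-$p$ group for some prime number $p$.
   Context: A pro-(finite nilpotent) group is an inverse limit of finite nilpotent groups (a profinite group all of whose finite continuous quotients are nilpotent). An envelope of a profinite group $G$ is a pair $(L,\eta)$ where $L$ is a topological group and $\eta:G\to L$ is an injective homomorphism such that $\eta(G)$ is open in $L$ and $\eta$ is a homeomorphism onto $\eta(G)$. An envelope is compactly generated (generated by a compact subset) or topologically simple (non-trivial, with no closed normal subgroups other than $\{1\}$ and itself) if $L$ is. *)

(* Defs.v *)
From HB Require Import structures.
From mathcomp Require Import all_boot all_order all_fingroup all_solvable.
From mathcomp Require Import boolp classical_sets functions cardinality topology.

Set Implicit Arguments.
Unset Strict Implicit.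
Unset Printing Implicit Defensive.

Local Open Scope classical_set_scope.
Local Open Scope group_scope.

(* No separation axiom is part of the structure: profinite groups are assumed
   Hausdorff below, and a group with a Hausdorff open subgroup is Hausdorff. *)
HB.mixin Record isTopologicalGroup G & Topological G & monoid.Group G := {
  mulg_continuous : continuous (fun x : G * G => x.1 * x.2) ;
  invg_continuous : continuous (fun x : G => x^-1) ;
}.

#[short(type="topologicalGroupType")]
HB.structure Definition TopologicalGroup :=
  {G of Topological G & monoid.Group G & isTopologicalGroup G}.

Definition subgroup (G : groupType) (A : set G) : Prop :=
  [/\ A 1, forall x y, A x -> A y -> A (x * y) & forall x, A x -> A x^-1].

Definition normal_subgroup (G : groupType) (A : set G) : Prop :=
  subgroup A /\ forall x y, A x -> A (x ^ y).

Definition profinite (G : topologicalGroupType) : Prop :=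
  [/\ compact [set: G], hausdorff_space G & totally_disconnected [set: G]].

(* Finite continuous quotients are presented as the continuous surjective
   homomorphisms onto finite discrete groups. *)
Definition pro (C : finGroupType -> Prop) (G : topologicalGroupType) : Prop :=
  profinite G /\
  forall (H : finGroupType) (f : {multiplicative G -> H}),
    continuous (f : G -> discrete_topology H) -> range f = [set: H] -> C H.

Definition pro_nilpotent : topologicalGroupType -> Prop :=
  pro (fun H => nilpotent [set: H]%SET).

Definition pro_p (p : nat) : topologicalGroupType -> Prop :=
  pro (fun H => p.-group [set: H]%SET).

(* The last condition is the continuity of eta^-1 on the subspace range eta;
   the values of g outside of range eta are irrelevant. *)
Definition envelope (G L : topologicalGroupType) (eta : {multiplicative G -> L})
    : Prop :=
  [/\ injective eta, open (range eta), continuous eta &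
      exists2 g : L -> G, cancel eta g & {within range eta, continuous g}].

Definition compactly_generated (L : topologicalGroupType) : Prop :=
  exists2 K : set L, compact K & smallest (@subgroup L) K = [set: L].

Definition topologically_simple (L : topologicalGroupType) : Prop :=
  [set: L] <> [set 1] /\
  forall N : set L, closed N -> normal_subgroup N -> N = [set 1] \/ N = [set: L].

(* Main.v *)
Require Import Defs.
From HB Require Import structures.
From mathcomp Require Import all_boot all_order all_fingroup all_solvable.
From mathcomp Require Import boolp classical_sets functions cardinality topology.

(* View G as an open subgroup of L. A pronilpotent G is the product of its Sylow
   subgroups G_p, and the property of lying in some pro-p subgroup is invariant
   under conjugation in L, so L commensurates every G_p. Since L is generated by
   G and a finite set S, for all but finitely many p the elements of S normalise
   G_p, which is then normal in L and hence trivial. For a remaining p, the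
   elements of L centralising an open subgroup of G_p form a normal subgroup of
   L containing G_q for all q <> p. If it is trivial then G = G_p. Otherwise it is
   dense, S can be chosen inside it, and S and G normalise an open subgroup of
   G_p, which is trivial by simplicity, so that G_p is finite. As G is infinite,
   this cannot happen for all p. *)

Set Implicit Arguments.
Unset Strict Implicit.
Unset Printing Implicit Defensive.

Local Open Scope classical_set_scope.
Local Open Scope group_scope.

(** * Compactness and clopen neighbourhoods *)

Lemma compact_seq_cover (T : topologicalType) (I : eqType) (K : set T)
    (D : set I) (P : I -> set T) :
  compact K -> (forall x, K x -> exists2 i, D i & nbhs x (P i)) ->
  exists2 s : seq I, {in s, forall i, D i} &
    forall x, K x -> exists2 i, i \in s & P i x.
Proof.
move=> /compact_near_coveringP cK cover.
(* A set is in [F] when it has as members all sequences containing some fixed [s0] taken from [D];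
   along [F] the near-covering property yields one sequence for all of [K]. *)
pose F (A : set (seq I)) := exists2 s0 : seq I, {in s0, forall i, D i} &
  forall s : seq I, {subset s0 <= s} -> A s.
have FF : Filter F.
  split; first by exists [::].
    move=> A B [s Ds sA] [t Dt tB]; exists (s ++ t).
      by move=> i; rewrite mem_cat => /orP[/Ds|/Dt].
    move=> u stu; split; [apply: sA|apply: tB] => i iu;
      by apply: stu; rewrite mem_cat iu ?orbT.
  by move=> A B AB [s Ds sA]; exists s => // t /sA /AB.
have [x Kx|s Ds sK] := cK _ F (fun s x => exists2 i, i \in s & P i x) FF.
  have [i Di xi] := cover x Kx.
  exists (P i, [set s : seq I | i \in s]).
    split => //=; exists [:: i]; first by move=> j; rewrite inE => /eqP->.
    by move=> s; apply; rewrite inE.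
  by case=> y s [/= Piy si]; exists i.
by exists s => // x Kx; apply: (sK s).
Qed.

(* The intersection of the clopen neighbourhoods of x is connected: normality
   separates the two pieces of a partition of it, and by compactness some
   clopen neighbourhood of x lies in the union of the separating sets. *)
Lemma compact_totally_disconnected_zero_dimensional (T : topologicalType) :
  compact [set: T] -> hausdorff_space T -> totally_disconnected [set: T] ->
  zero_dimensional T.
Proof.
move=> cT hT tdT x y xy.
pose Q := \bigcap_(C in [set C : set T | clopen C /\ C x]) C.
suff cQ : connected Q.
  apply: contrapT => nC; suff Qy : Q y.
    have : connected_component [set: T] x y.
      by exists Q => //; split => // C [].
    by rewrite tdT //= => yx; rewrite yx eqxx in xy.
  by move=> C [cC Cx]; apply: contrapT => Cy; apply: nC; exists C.
have Qclosed : closed Q by apply: closed_bigI => C [[]].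
have Qx : Q x by move=> C [].
have in_open O : open O -> Q `<=` O -> exists C, [/\ clopen C, C x & C `<=` O].
  move=> oO QO.
  have cO : compact (~` O) by exact: subclosed_compact (open_closedC oO) cT _.
  have [z Oz|s sD sO] := @compact_seq_cover T (set T) (~` O)
      [set C | clopen C /\ C x] (fun C => ~` C) cO.
    apply: contrapT => nC; apply: Oz; apply: QO => C [clC Cx].
    apply: contrapT => Cz; apply: nC; exists C => //.
    by apply: open_nbhs_nbhs; split => //; apply: closed_openC; case: clC.
  exists (\bigcap_(C in [set` s]) C); split.
  - elim: s sD {sO} => [|C s IH] sD; first by rewrite set_nil bigcap_set0; apply: clopenT.
    have -> : \bigcap_(D in [set` C :: s]) D = C `&` \bigcap_(D in [set` s]) D.
      rewrite predeqE => z; split=> [Cz|[Cz sz] D /=].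
        by split=> [|D Ds]; apply: Cz; rewrite /= inE ?eqxx // (Ds : D \in s) orbT.
      by rewrite inE => /orP[/eqP-> //|]; apply: sz.
    apply: clopenI; first by have [] := sD C (mem_head _ _).
    by apply: IH => D Ds; apply: sD; rewrite inE Ds orbT.
  - by move=> C /sD [].
  - by move=> z sz; apply: contrapT => /sO [C Cs]; apply; apply: sz.
move=> B [b Bb] [O oO BO] [C cC BC].
have Bclosed : closed B by rewrite BC; apply: closedI.
have Dclosed : closed (Q `&` ~` O) by apply: closedI => //; apply: open_closedC.
have nbB : set_nbhs B (~` (Q `&` ~` O)).
  move=> z Bz; apply: open_nbhs_nbhs; split; first exact: closed_openC.
  by rewrite BO in Bz; case: Bz => ? ? [].
have [V BV clV] := compact_normal hT cT Bclosed nbB.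
pose O1 := interior V; pose O2 := ~` closure V.
have oO1 : open O1 by apply: open_interior.
have oO2 : open O2 by apply: closed_openC; apply: closed_closure.
have O12 z : O1 z -> O2 z -> False.
  by move=> /interior_subset Vz; apply; apply: subset_closure.
have QBO z : Q z -> O z -> O1 z by move=> Qz Oz; apply: BV; rewrite BO.
have QDO z : Q z -> ~ O z -> O2 z by move=> Qz Oz /clV; apply.
have [U [[oU cU] Ux UO]] : exists C, [/\ clopen C, C x & C `<=` O1 `|` O2].
  apply: in_open; first exact: openU.
  by move=> z Qz; have [Oz|Oz] := pselect (O z); [left; apply: QBO|right; apply: QDO].
have clU1 : clopen (U `&` O1).
  split; first exact: openI.
  have -> : U `&` O1 = U `&` ~` O2; last by apply: closedI => //; apply: open_closedC.
  rewrite predeqE => z; split=> [[Uz z1]|[Uz z2]]; split => //; first by move/(O12 z z1).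
  by case: (UO z Uz).
have clU2 : clopen (U `&` O2).
  split; first exact: openI.
  have -> : U `&` O2 = U `&` ~` O1; last by apply: closedI => //; apply: open_closedC.
  rewrite predeqE => z; split=> [[Uz z1]|[Uz z2]]; split => //; first by move/O12; apply.
  by case: (UO z Uz).
(* The pieces of [U] are clopen, so the one that contains [x] contains all of [Q]. *)
have [Ox|Ox] := pselect (O x).
  rewrite BO predeqE => z; split=> [[]//|Qz]; split => //.
  have [_ z1] : (U `&` O1) z by apply: Qz; split => //; split => //; apply: QBO.
  by apply: contrapT => /(QDO z Qz) /O12; apply.
have Bb' := Bb; rewrite BO in Bb'; case: Bb' => Qb Ob.
have [_ z2] : (U `&` O2) b by apply: Qb; split => //; split => //; apply: QDO.
by case: (O12 b) => //; apply: QBO.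
Qed.

(** * Homomorphisms and subgroups of abstract groups *)

Section Multiplicative.
Variables (G H : groupType) (f : {multiplicative G -> H}).

Lemma multiplicative1 : f 1 = 1.
Proof. by apply: (mulgI (f 1)); rewrite -gmulfM !mulg1. Qed.

Lemma multiplicativeV x : f x^-1 = (f x)^-1.
Proof. by apply: (mulgI (f x)); rewrite -gmulfM !mulgV multiplicative1. Qed.

Lemma multiplicativeX x n : f (x ^+ n) = f x ^+ n.
Proof. by elim: n => [|n IH]; rewrite ?multiplicative1 // !expgS gmulfM IH. Qed.

Lemma multiplicativeJ x y : f (x ^ y) = f x ^ f y.
Proof. by rewrite !conjgE !gmulfM multiplicativeV. Qed.

Lemma multiplicative_eq x y : f x = f y <-> f (x^-1 * y) = 1.
Proof.
rewrite gmulfM multiplicativeV; split=> [->|e]; first exact: mulVg.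
by apply: (mulgI (f x)^-1); rewrite e mulVg.
Qed.

End Multiplicative.

Lemma multiplicative_of_morph (G H : groupType) (f : G -> H) :
  {morph f : x y / x * y} -> exists g : {multiplicative G -> H}, g =1 f.
Proof.
move=> fM; pose m := isMultiplicative.Build G H f fM.
by exists (HB.pack f m : {multiplicative G -> H}).
Qed.

Section Subgroup.
Variables (G : groupType) (A : set G).
Hypothesis sA : subgroup A.

Lemma subgroup1 : A 1. Proof. by case: sA. Qed.

Lemma subgroupM x y : A x -> A y -> A (x * y).
Proof. by case: sA => _ AM _; apply: AM. Qed.

Lemma subgroupV x : A x -> A x^-1.
Proof. by case: sA => _ _; apply. Qed.

End Subgroup.

(** * Open subgroups and coset actions *)

Section TopologicalGroup.
Variable G : topologicalGroupType.
Implicit Types (x y z : G) (A B : set G).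

Lemma nbhs_mulg x y A : nbhs (x * y) A ->
  exists2 B : set G * set G, nbhs x B.1 /\ nbhs y B.2 &
    forall a b, B.1 a -> B.2 b -> A (a * b).
Proof.
move=> xyA; have [B nB BA] := @mulg_continuous G (x, y) A xyA.
by exists B => // a b Ba Bb; apply: (BA (a, b)).
Qed.

Lemma mulgl_continuous x : continuous (fun y => x * y).
Proof.
move=> y A /nbhs_mulg [B [Bx By] BA].
by apply: filterS By => b; apply: BA; apply: nbhs_singleton.
Qed.

Lemma mulgr_continuous y : continuous (fun x => x * y).
Proof.
move=> x A /nbhs_mulg [B [Bx By] BA].
by apply: filterS Bx => a aB; apply: BA => //; apply: nbhs_singleton.
Qed.

Lemma conjg_continuous y : continuous (fun x => x ^ y).
Proof.
move=> x A xyA.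
exact: (@mulgr_continuous y x _ (@mulgl_continuous y^-1 (x * y) A xyA)).
Qed.

Lemma nbhs_translate x A : nbhs 1 A -> nbhs x [set y | A (x^-1 * y)].
Proof. by move=> nA; apply: mulgl_continuous; rewrite mulVg. Qed.

Lemma nbhs_conjg x A : nbhs 1 A -> nbhs 1 [set y | A (y ^ x)].
Proof. by move=> nA; apply: conjg_continuous; rewrite conj1g. Qed.

(* V is the stabiliser of a clopen neighbourhood of 1 under left translation. *)
Lemma profinite_open_subgroup A : profinite G -> nbhs 1 A ->
  exists V : set G, [/\ subgroup V, nbhs 1 V & V `<=` A].
Proof.
move=> [cG hG tdG] nA.
have zG := compact_totally_disconnected_zero_dimensional cG hG tdG.
have [C [C1 [oC cC]] CA] := zero_dimensional_cvg hG zG cG nA.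
pose V := [set x | (forall c, C c -> C (x * c)) /\ (forall c, C c -> C (x^-1 * c))].
exists V; split.
- split=> [|x y [x1 x2] [y1 y2]|x [x1 x2]].
  + by split=> c; rewrite ?invg1 mul1g.
  + split=> c Cc; rewrite ?invMg -mulgA; first by apply/x1/y1.
    by apply/y2/x2.
  + by split; rewrite ?invgK.
(* Compactness of [C] makes the neighbourhood of 1 uniform in [c]. *)
- have /compact_near_coveringP cC' : compact C by exact: subclosed_compact cC cG _.
  have n1 : nbhs 1 [set x | forall c, C c -> C (x * c)].
    apply: (cC' G (nbhs 1) (fun x c => C (x * c))) => c Cc.
    have : nbhs (1 * c) C by rewrite mul1g; apply: open_nbhs_nbhs.
    move=> /nbhs_mulg [B [B1 B2] BC]; exists (B.2, B.1) => //.
    by case=> a b [/= ? ?]; apply: BC.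
  have n2 : nbhs 1 [set x | forall c, C c -> C (x^-1 * c)].
    apply: (@invg_continuous G 1 [set x | forall c, C c -> C (x * c)]).
    by rewrite /= invg1.
  by apply: filterI n1 n2.
- by move=> x [/(_ _ C1)]; rewrite mulg1 => + _; apply: CA.
Qed.

(** If [t] in [N] represents the coset of [g], then [t * U] is a neighbourhood of [g]. With [N]
    everything and [K = G] this gives finite index; with [N] dense it gives representatives inside
    [N]. *)
Lemma compact_seq_translates (K N U : set G) : compact K ->
  nbhs 1 U -> (forall g, exists2 t, N t & U (t^-1 * g)) -> subgroup U ->
  exists2 s : seq G, {in s, forall t, N t} &
    forall g, K g -> exists2 t, t \in s & U (t^-1 * g).
Proof.
move=> cK nU NU sU.
apply: (@compact_seq_cover G G K N (fun t g => U (t^-1 * g)) cK) => g _.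
have [t Nt Ut] := NU g; exists t => //.
apply: filterS (nbhs_translate g nU) => h /= Uh.
by rewrite -[h](mulVKg g) mulgA; apply: subgroupM.
Qed.

(* f is the action on the left cosets of V, with g acting through g^-1 because
   permutations compose from left to right. *)
Lemma open_subgroup_perm (V : set G) : compact [set: G] -> subgroup V ->
  nbhs 1 V -> exists (T : finType) (f : {multiplicative G -> {perm T}}),
    nbhs 1 [set x | f x = 1] /\ forall x, f x = 1 -> V x.
Proof.
move=> cG sV nV.
have [|s _ sG] := compact_seq_translates (N := setT) cG nV _ sV.
  by move=> g; exists g => //; rewrite mulVg; apply: subgroup1.
(* The position of the first representative of the coset of [g]; the bound [(size s).+1] also
   accommodates the value [size s] that [find] returns on failure. *)
pose r g : 'I_(size s).+1 := inord (find (fun t => `[< V (t^-1 * g) >]) s).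
have rP g h : r g = r h <-> V (g^-1 * h).
  have sP k : has (fun t => `[< V (t^-1 * k) >]) s.
    by have [t ts Vt] := sG k I; apply/hasP; exists t => //; apply/asboolP.
  split=> [/(congr1 (@nat_of_ord _))|Vgh].
    rewrite /r !inordK ?ltnS ?find_size // => e.
    have /asboolP Vg := nth_find 1 (sP g); have /asboolP Vh := nth_find 1 (sP h).
    rewrite -e in Vh; set t := nth _ _ _ in Vg Vh.
    have -> : g^-1 * h = (t^-1 * g)^-1 * (t^-1 * h).
      by rewrite invMg invgK mulgA mulgK.
    by apply: subgroupM => //; apply: subgroupV.
  congr inord; apply: eq_find => t; apply/asboolP/asboolP => Vt.
    by rewrite -[h](mulVKg g) mulgA; apply: subgroupM.
  rewrite -[g](mulgK (g^-1 * h)) mulVKg mulgA; apply: subgroupM => //.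
  exact: subgroupV.
(* Only attained indices are kept, so the points of [T] are exactly the left cosets of [V]. *)
pose T := {i : 'I_(size s).+1 | `[< exists g, r g = i >]}.
have Pr g : `[< exists h, r h = r g >] by apply/asboolP; exists g.
pose q g : T := exist _ (r g) (Pr g).
have qP g h : q g = q h <-> V (g^-1 * h).
  rewrite -rP; split=> [/(congr1 val)//|e]; exact: val_inj.
have /choice [c cP] : forall t : T, exists g, q g = t.
  by case=> i /[dup] /asboolP [g rg] p; exists g; apply: val_inj.
have q_mul g x y : q x = q y -> q (g * x) = q (g * y).
  by move=> /qP e; apply/qP; rewrite invMg -mulgA mulKg.
have sig_inj g : injective (fun t => q (g^-1 * c t)).
  move=> t u /= /(q_mul g); rewrite !mulVKg !cP //.
pose sig g := perm (sig_inj g).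
have sigM : {morph sig : g h / g * h}.
  move=> g h; apply/permP => t; rewrite permM !permE /= invMg -mulgA.
  by apply: q_mul; rewrite cP.
have [f fE] := multiplicative_of_morph sigM.
exists T, f; split; last first.
  move=> x; rewrite fE => e; have := permE (sig_inj x) (q 1).
  rewrite -/(sig x) e perm1 => /qP; rewrite invg1 mul1g => h.
  have Vc : V (c (q 1)) by have /qP := cP (q 1); rewrite mulg1 => /(subgroupV sV); rewrite invgK.
  rewrite -[x]invgK; apply: subgroupV => //.
  by rewrite -(mulgK (c (q 1)) x^-1); apply: subgroupM => //; apply: subgroupV.
(* [x] fixes the coset of [c t] exactly when [x ^ c t] lies in [V], so the kernel contains a finite
   intersection of conjugates of [V]. *)
have : nbhs 1 [set x | forall t, V (x ^ c t)].
  by apply: filter_forall => t; apply: nbhs_conjg.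
apply: filterS => x Vx; rewrite /= fE; apply/permP => t.
rewrite permE perm1 -[RHS]cP; apply/qP; rewrite invMg invgK -mulgA.
exact: Vx.
Qed.

Lemma closureM A B C x y : (forall a b, A a -> B b -> C (a * b)) ->
  closure A x -> closure B y -> closure C (x * y).
Proof.
move=> ABC clx cly D /nbhs_mulg [E [Ex Ey] ED].
have [a [Aa Ea]] := clx _ Ex; have [b [Bb Eb]] := cly _ Ey.
by exists (a * b); split; [apply: ABC|apply: ED].
Qed.

Lemma closure_normal_subgroup A : normal_subgroup A -> normal_subgroup (closure A).
Proof.
move=> [sA nA]; split=> [|x y clx B nB]; last first.
  have [a [Aa Ba]] := clx _ (conjg_continuous nB).
  by exists (a ^ y); split=> //; apply: nA.
split=> [|x y|x clx B nB].
- by apply: subset_closure; apply: subgroup1.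
- by apply: closureM => a b; apply: subgroupM.
- have [a [Aa Ba]] := clx _ (@invg_continuous G x B nB).
  by exists a^-1; split=> //; apply: subgroupV.
Qed.

End TopologicalGroup.

Lemma normalizer_subgroup (G : groupType) (V : set G) :
  subgroup [set g | forall x, V (x ^ g) <-> V x].
Proof.
split=> [x|g h Vg Vh x|g Vg x]; first by rewrite conjg1.
  by rewrite conjgM Vh.
by rewrite -Vg conjgKV.
Qed.

Lemma filter_forall_seq (T : Type) (I : eqType) (F : set_system T) (s : seq I)
    (P : I -> set T) :
  Filter F -> {in s, forall i, F (P i)} -> F [set x | {in s, forall i, P i x}].
Proof.
move=> FF; elim: s => [|i s IH] FP; first by apply: filterS filterT.
have Fi : F (P i) by apply: FP; apply: mem_head.
have Fs : F [set x | {in s, forall i, P i x}].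
  by apply: IH => j js; apply: FP; rewrite inE js orbT.
apply: filterS2 Fi Fs => x Pi Ps j; rewrite inE => /orP[/eqP-> //|]; exact: Ps.
Qed.

(** * Finite continuous quotients *)

Section FiniteQuotients.
Variable G : topologicalGroupType.

Lemma nbhs_kernel (H : groupType) (f : {multiplicative G -> H}) x :
  nbhs 1 [set y | f y = 1] -> nbhs x [set y | f y = f x].
Proof.
move=> /(nbhs_translate x); apply: filterS => y /= e.
by apply/esym/multiplicative_eq.
Qed.

Lemma continuous_kernel (H : finGroupType) (f : {multiplicative G -> H}) :
  continuous (f : G -> discrete_topology H) <-> nbhs 1 [set x | f x = 1].
Proof.
split=> [cf|kf x A].
  apply: (cf 1 [set 1]); rewrite multiplicative1.
  by rewrite nbhs_principalE.
rewrite nbhs_principalE => Ax.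
by apply: filterS (nbhs_kernel x kf) => y /= ->; apply: Ax.
Qed.

(** [pro] only constrains surjections, so the target is cut down to the image, made into a group
    type of its own. *)
Lemma multiplicative_factor_range (H : finGroupType) (f : {multiplicative G -> H}) :
  exists (K : finGroupType) (g : {multiplicative G -> K}),
    range g = [set: K] /\ forall x, g x = 1 <-> f x = 1.
Proof.
pose R := [set y : H | `[< exists x, f x = y >]]%SET.
have RP y : y \in R <-> exists x, f x = y.
  by rewrite finset.inE; split=> /asboolP.
have gR : group_set R.
  apply/group_setP; split=> [|y z].
    by apply/RP; exists 1; apply: multiplicative1.
  move=> /RP[a <-] /RP[b <-]; apply/RP.
  by exists (a * b); apply: gmulfM.
pose RG := group gR.
have fR x : f x \in RG by apply/RP; exists x.
have subgM : {morph (fun x => subg RG (f x)) : x y / x * y}.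
  by move=> x y; rewrite gmulfM morphM.
have [g gE] := multiplicative_of_morph subgM.
exists (subg_of RG), g; split=> [|x].
  rewrite predeqE => u; split=> // _.
  have /RP [x fx] := subgP u.
  by exists x => //; rewrite gE fx sgvalK.
rewrite gE; split=> [e|->]; last exact: morph1.
by rewrite -(subgK _ (fR x)) e.
Qed.

Lemma profinite_quotient (A : set G) : profinite G -> nbhs 1 A ->
  exists (H : finGroupType) (f : {multiplicative G -> H}),
    [/\ nbhs 1 [set x | f x = 1], range f = [set: H] &
        forall x, f x = 1 -> A x].
Proof.
move=> pG nA; have [V [sV nV VA]] := profinite_open_subgroup pG nA.
have [cG _ _] := pG.
have [T [f [nf fV]]] := open_subgroup_perm cG sV nV.
have [K [g [rg gf]]] := multiplicative_factor_range f.
exists K, g; split=> //; last by move=> x /gf /fV /VA.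
by apply: filterS nf => x /= /gf.
Qed.

(** Residual finiteness: the complement of a point other than 1 is a neighbourhood of 1, so it
    contains the kernel of a finite quotient. *)
Lemma profinite_eq1 (x : G) : profinite G ->
  (forall (H : finGroupType) (f : {multiplicative G -> H}),
    nbhs 1 [set x | f x = 1] -> range f = [set: H] -> f x = 1) -> x = 1.
Proof.
move=> pG x1; apply: contrapT => nx; have [_ hG _] := pG.
have [|H [f [nf rf fx]]] := profinite_quotient (A := ~` [set x]) pG.
  apply: open_nbhs_nbhs; split; last by move=> /= e; apply: nx.
  apply: closed_openC; apply: accessible_closed_set1.
  exact: hausdorff_accessible.
by apply: (fx x) => //; apply: x1.
Qed.

End FiniteQuotients.

(* For a profinite group this says that x generates a pro-pi subgroup; no
   ambient compact subgroup is mentioned, so the condition is invariant under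
   conjugation in any topological group. *)
Definition pro_elt (G : topologicalGroupType) (pi : nat_pred) (x : G) :=
  forall A : set G, nbhs 1 A -> exists2 k, pi.-nat k & A (x ^+ k).

(** * Pro-pi elements *)

Section ProElements.
Variables (G : topologicalGroupType) (pi : nat_pred).

Lemma pro_eltJ (x y : G) : pro_elt pi x -> pro_elt pi (x ^ y).
Proof.
move=> px A /(nbhs_conjg y) /px [k pk Ak].
by exists k => //; rewrite -conjXg.
Qed.

Lemma pro_elt_p_elt (H : finGroupType) (f : {multiplicative G -> H}) x :
  nbhs 1 [set x | f x = 1] -> pro_elt pi x -> pi.-elt (f x).
Proof.
move=> nf /(_ _ nf) [k pk /=]; rewrite multiplicativeX => e.
by apply: pnat_dvd pk; rewrite order_dvdn e.
Qed.

End ProElements.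

(** * Sylow decomposition of pronilpotent groups *)

Section ProNilpotent.
Variable G : topologicalGroupType.
Hypothesis nilG : pro_nilpotent G.
Implicit Type pi : nat_pred.

Lemma pro_nilpotent_profinite : profinite G. Proof. by case: nilG. Qed.

(** The pi-core of a finite nilpotent group is a Hall subgroup, so it contains every pi-element;
    this is what makes pi-elements closed under products. *)
Lemma pro_nilpotent_pcore pi (H : finGroupType) (f : {multiplicative G -> H}) (x : H) :
  nbhs 1 [set x | f x = 1] -> range f = [set: H] ->
  pi.-elt x = (x \in 'O_pi([set: H]%SET)).
Proof.
move=> /continuous_kernel cf rf; have nH := nilG.2 H f cf rf.
by rewrite (mem_Hall_pcore (nilpotent_pcore_Hall pi nH)) ?in_setT.
Qed.

Lemma pro_eltP pi (x : G) :
  (forall (H : finGroupType) (f : {multiplicative G -> H}),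
    nbhs 1 [set x | f x = 1] -> range f = [set: H] -> pi.-elt (f x)) ->
  pro_elt pi x.
Proof.
move=> fx A nA.
have [H [f [nf rf fA]]] := profinite_quotient pro_nilpotent_profinite nA.
exists #[f x]; first exact: fx.
by apply: fA; rewrite multiplicativeX expg_order.
Qed.

Lemma pro_elt_subgroup pi : subgroup (@pro_elt G pi).
Proof.
split=> [|x y px py|x px]; apply: pro_eltP => H f nf rf.
- by rewrite multiplicative1 /p_elt order1.
- rewrite gmulfM (pro_nilpotent_pcore _ (f := f)) // groupM //.
    by rewrite -(pro_nilpotent_pcore _ (f := f)) //; apply: pro_elt_p_elt.
  by rewrite -(pro_nilpotent_pcore _ (f := f)) //; apply: pro_elt_p_elt.
- by rewrite multiplicativeV p_eltV; apply: pro_elt_p_elt.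
Qed.

Lemma pro_elt_closed pi : closed (@pro_elt G pi).
Proof.
move=> x clx; apply: pro_eltP => H f nf rf.
have [y [py /= <-]] := clx _ (nbhs_kernel x nf).
exact: pro_elt_p_elt.
Qed.

(** In each finite quotient the two images lie in complementary direct factors, so the commutator
    dies there. *)
Lemma pro_elt_commute pi (x y : G) :
  pro_elt pi x -> pro_elt pi^'%N y -> commute x y.
Proof.
move=> px py; apply/commgP/eqP; apply: profinite_eq1.
  exact: pro_nilpotent_profinite.
move=> H f nf rf; have /continuous_kernel cf := nf.
have nH := nilG.2 H f cf rf.
have [_ _ cO _] := dprodP (nilpotent_pcoreC pi nH).
have fx : f x \in 'O_pi([set: H]%SET).
  by rewrite -(pro_nilpotent_pcore _ (f := f)) //; apply: pro_elt_p_elt px.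
have fy : f y \in 'O_(pi^'%N)([set: H]%SET).
  by rewrite -(pro_nilpotent_pcore _ (f := f)) //; apply: pro_elt_p_elt py.
have := centsP cO _ fy _ fx => /commute_sym /commgP /eqP.
by rewrite !commgEl !conjgE !gmulfM !multiplicativeV.
Qed.

(* The constituents of the images of x in the finite quotients are compatible,
   and compactness provides a common lift. *)
Lemma pro_elt_constt pi (x : G) : exists a : G,
  forall (H : finGroupType) (f : {multiplicative G -> H}),
    nbhs 1 [set x | f x = 1] -> f a = (f x).`_pi.
Proof.
pose F (B : set G) := exists (H : finGroupType) (f : {multiplicative G -> H}),
  nbhs 1 [set x | f x = 1] /\ forall y, f y = (f x).`_pi -> B y.
have consttX (H : finGroupType) (f : {multiplicative G -> H}) :
    exists y, f y = (f x).`_pi.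
  by have /cycleP [k ->] := cycle_constt pi (f x); exists (x ^+ k); apply: multiplicativeX.
have FF : ProperFilter F.
  apply: Build_ProperFilter.
    by move=> [H [f [_ fB]]]; case: (consttX H f) => y /fB.
  split; last by move=> B C BC [H [f [nf fB]]]; exists H, f; split=> // y /fB /BC.
    have oneM : {morph (fun _ : G => 1 : {perm 'I_1}) : y z / y * z}.
      by move=> y z; rewrite mulg1.
    have [f fE] := multiplicative_of_morph oneM.
    by exists {perm 'I_1}, f; split=> //; apply: filterS filterT => y _; apply: fE.
  move=> B C [H [f [nf fB]]] [K [g [ng gC]]].
  (* Constituents in a product are computed coordinatewise, so the fibre of the pair map lies in
     both given fibres. *)
  have fgM : {morph (fun y => (f y, g y)) : y z / y * z}.
    by move=> y z; rewrite !gmulfM.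
  have [h hE] := multiplicative_of_morph fgM.
  exists ((H * K)%type : finGroupType), h; split.
    by apply: filterS2 nf ng => y /= fy gy; rewrite hE fy gy.
  move=> y; rewrite !hE => e; split; [apply: fB|apply: gC].
    have := morph_constt [morphism of @fst H K] pi (finset.in_setT (f x, g x)).
    by rewrite -e.
  have := morph_constt [morphism of @snd H K] pi (finset.in_setT (f x, g x)).
  by rewrite -e.
have [cG _ _] := pro_nilpotent_profinite.
have [|a [_ Fa]] := cG F FF; first exact: filterT.
exists a => H f nf.
have [|y [fy /= fa]] := Fa [set y | f y = (f x).`_pi] _ _ (nbhs_kernel a nf).
  by exists H, f.
by rewrite -fa.
Qed.

(** [a] lifts the pi-constituents of [x]. The last clause keeps [a] inside every open kernel that
    contains [x]. *)
Lemma pro_elt_decomposition pi (x : G) : exists a b : G,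
  [/\ x = b * a, pro_elt pi a, pro_elt pi^'%N b &
      forall (H : finGroupType) (f : {multiplicative G -> H}),
        nbhs 1 [set x | f x = 1] -> f x = 1 -> f a = 1].
Proof.
have [a fa] := pro_elt_constt pi x; exists a, (x * a^-1).
split; first by rewrite mulgVK.
- by apply: pro_eltP => H f nf rf; rewrite fa //; apply: p_elt_constt.
- apply: pro_eltP => H f nf rf; rewrite gmulfM multiplicativeV fa //.
  exact: p'_elt_constt.
- by move=> H f nf fx; rewrite fa // fx constt1.
Qed.

(** By Cauchy, a prime [q] dividing the order of a quotient is the order of some [f x]; here [x]
    equals its pro-p part, so [q = p]. *)
Lemma pro_p_trivial_complement (p : nat) :
  (forall x : G, pro_elt p^'%N x -> x = 1) -> pro_p p G.
Proof.
move=> p'1; split=> [|H f /continuous_kernel nf rf]; first exact: pro_nilpotent_profinite.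
apply/pgroupP => q pq /(Cauchy pq) [y _ oy].
have [x _ fx] : range f y by rewrite rf.
have [a [b [xba pa p'b _]]] := pro_elt_decomposition p x.
have := pro_elt_p_elt nf pa.
by rewrite -[a]mul1g -(p'1 b p'b) -xba fx /p_elt oy pnatE.
Qed.

End ProNilpotent.

Lemma infinite_kernel (G : topologicalGroupType) (H : finGroupType)
    (f : {multiplicative G -> H}) :
  infinite_set [set: G] -> exists2 x, f x = 1 & x <> 1.
Proof.
move=> iG; apply: contrapT => k1; apply: iG.
have := @finite_preimage _ _ [set: H] f; rewrite preimage_setT; apply=> //.
move=> x y _ _ /multiplicative_eq e; rewrite -[x]invgK; apply: mulg1_eq.
by apply: contrapT => xy1; apply: k1; exists (x^-1 * y).
Qed.

(** * The open embedding of a group in its envelope *)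

Section Envelope.
Variables (G L : topologicalGroupType) (eta : {multiplicative G -> L}).
Hypothesis env : envelope eta.
Let U : set L := range eta.

Lemma envelope_inj : injective eta. Proof. by case: env. Qed.

Lemma envelope_nbhs (x : G) (B : set G) : nbhs x B -> nbhs (eta x : L) (eta @` B).
Proof.
case: env => _ _ _ [g gK cg] nB.
have ngB : nbhs (g (eta x)) B by rewrite gK.
have /= := cg (eta x) B ngB.
case: (nbhs_subspaceP (range eta) (eta x)) => [_ W|[]]; last by exists x.
have nU : nbhs (eta x) U by case: env => _ oU _ _; apply: open_nbhs_nbhs; split=> //; exists x.
apply: (@filterS2 L (nbhs (eta x)) _ _ _ _ _ W nU) => y Wy [z _ zy].
have Bgy : B (g y) by apply: Wy; exists z.
by exists z => //; rewrite -zy gK in Bgy.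
Qed.

Lemma envelope_preimage (A : set L) : nbhs 1 A -> nbhs 1 (eta @^-1` A).
Proof. by case: env => _ _ ceta _ nA; apply: ceta; rewrite multiplicative1. Qed.

Lemma envelope_open1 : nbhs (1 : L) U.
Proof.
have n1 : nbhs (1 : G) setT by exact: filterT.
have := envelope_nbhs n1; rewrite multiplicative1.
by apply: filterS => _ [x _ <-]; exists x.
Qed.

Lemma image_subgroup (W : set G) : subgroup W -> subgroup (eta @` W).
Proof.
move=> sW; split=> [|_ _ [x Wx <-] [y Wy <-]|_ [x Wx <-]].
- by exists 1; [apply: subgroup1|apply: multiplicative1].
- by exists (x * y); [apply: subgroupM|apply: gmulfM].
- by exists x^-1; [apply: subgroupV|apply: multiplicativeV].
Qed.

Lemma envelope_subgroup : subgroup U.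
Proof. exact: image_subgroup. Qed.

(** If [y] is a limit point, its coset [y * U] meets the image, so [y] lies in [U]; closedness is
    then tested in [G]. *)
Lemma envelope_closed (B : set G) : closed B -> closed (eta @` B).
Proof.
move=> cB y cly.
have [_ [[b Bb <-] [c _ cb]]] := cly _ (nbhs_translate y envelope_open1).
pose x := b * c^-1; have xy : eta x = y.
  by rewrite gmulfM multiplicativeV cb invMg invgK mulVKg.
exists x => //; apply: cB => C nC.
have := envelope_nbhs nC; rewrite xy => /cly [_ [[d Bd <-] [e Ce /envelope_inj ed]]].
by exists d; split=> //; rewrite -ed.
Qed.

Lemma envelope_pro_elt pi (x : G) : pro_elt pi (eta x) <-> pro_elt pi x.
Proof.
split=> px A nA.
  have := envelope_nbhs nA; rewrite multiplicative1 => /px [k pk [a Aa]].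
  by rewrite -multiplicativeX => /envelope_inj e; exists k; rewrite // -e.
have [k pk Ak] := px _ (envelope_preimage nA).
by exists k => //; rewrite -multiplicativeX.
Qed.

(** * Consequences of simplicity and compact generation *)

Hypothesis nilG : pro_nilpotent G.
Hypothesis infG : infinite_set [set: G].
Hypothesis cgL : compactly_generated L.
Hypothesis simpleL : topologically_simple L.

Lemma kernel_normal (H : finGroupType) (f : {multiplicative G -> H}) :
  normal_subgroup [set x | f x = 1].
Proof.
split=> [|x y /= fx]; last by rewrite multiplicativeJ fx conj1g.
split=> [|x y /= fx fy|x /= fx]; first exact: multiplicative1.
  by rewrite gmulfM fx fy mulg1.
by rewrite multiplicativeV fx invg1.
Qed.

Lemma kernel_closed (H : finGroupType) (f : {multiplicative G -> H}) :
  nbhs 1 [set x | f x = 1] -> closed [set x | f x = 1].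
Proof.
by move=> nf x clx; have [y [/= fy <-]] := clx _ (nbhs_kernel x nf).
Qed.

(* Otherwise L would be isomorphic to G, an infinite profinite group, which is
   not topologically simple. *)
Lemma envelope_normal_trivial (W : set G) : closed W ->
  normal_subgroup (eta @` W) -> W = [set 1].
Proof.
move=> cW nW; have [ntL] := simpleL => /[dup] sL.
have W1 : eta @` W = [set 1] -> W = [set 1].
  move=> e; rewrite predeqE => x; split=> [Wx|->] /=.
    apply: envelope_inj; rewrite multiplicative1.
    have : (eta @` W) (eta x) by exists x.
    by rewrite e.
  have [y Wy e1] := subgroup1 nW.1.
  by rewrite -(_ : y = 1) //; apply: envelope_inj; rewrite e1 multiplicative1.
case/(_ _ (envelope_closed cW) nW) => // WT; exfalso.
have surj y : exists x, eta x = y.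
  by have : [set: L] y by []; rewrite -WT => -[x _ <-]; exists x.
have [x x1] : exists x : G, x <> 1.
  have oneM : {morph (fun _ : G => 1 : {perm 'I_1}) : y z / y * z}.
    by move=> y z; rewrite mulg1.
  have [f _] := multiplicative_of_morph oneM.
  by have [x _ x1] := infinite_kernel f infG; exists x.
(* Now [eta] is onto, so each kernel of a finite quotient is normal in [L]; it is non-trivial as [G]
   is infinite, hence it is everything and [x] dies in the quotient. *)
apply: x1; apply: profinite_eq1; first by case: nilG.
move=> H f nf rf; have [y fy y1] := infinite_kernel f infG.
have [[sK nK] cK] := (kernel_normal f, kernel_closed nf).
have nK' : normal_subgroup (eta @` [set x | f x = 1]).
  split=> [|_ z [w fw <-]]; first exact: image_subgroup.
  have [v <-] := surj z; exists (w ^ v); last exact: multiplicativeJ.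
  exact: nK.
have [K1|KT] := sL _ (envelope_closed cK) nK'.
  case: y1; apply: envelope_inj; rewrite multiplicative1.
  have : (eta @` [set x | f x = 1]) (eta y) by exists y.
  by rewrite K1.
have : [set: L] (eta x) by [].
by rewrite -KT => -[z fz /envelope_inj <-].
Qed.

(** Finitely many cosets of [U] cover a compact generating set, with representatives taken in any
    [N] that meets every coset. *)
Lemma envelope_generators (N : set L) :
  (forall g, exists2 t, N t & U (t^-1 * g)) ->
  exists2 s : seq L, {in s, forall t, N t} &
    forall M : set L, subgroup M -> U `<=` M -> {in s, forall t, M t} -> M = [set: L].
Proof.
move=> NU; have [K cK genK] := cgL.
have [s sN sK] := compact_seq_translates cK envelope_open1 NU envelope_subgroup.
exists s => // M sM UM sM'; apply/seteqP; split=> // g _.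
have : smallest (@subgroup L) K `<=` M.
  apply: smallest_sub => // k /sK [t ts Ut].
  by rewrite -(mulVKg t k); apply: subgroupM => //; [apply: sM'|apply: UM].
by rewrite genK; apply.
Qed.

(** The normaliser of the image of [W] contains [U] and [s], hence is all of [L]. *)
Lemma envelope_normalized_trivial (s : seq L) (W : set G) :
  (forall M : set L, subgroup M -> U `<=` M -> {in s, forall t, M t} -> M = [set: L]) ->
  closed W -> normal_subgroup W ->
  {in s, forall t x, (eta @` W) (x ^ t) <-> (eta @` W) x} -> W = [set 1].
Proof.
move=> gen cW [sW nW] sWt; apply: envelope_normal_trivial => //.
split; first exact: image_subgroup.
have MT := gen _ (normalizer_subgroup (eta @` W)) _ sWt.
move=> x y Wx; have : [set: L] y by [].
rewrite -MT; first by move/(_ x) => [_]; apply.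
move=> _ [u _ <-] z; split=> -[w Ww e].
  exists (w ^ u^-1); first exact: nW.
  by rewrite multiplicativeJ multiplicativeV e conjgK.
by exists (w ^ u); [apply: nW|rewrite multiplicativeJ e].
Qed.

(* Take f with kernel inside every conjugate of U by a generator or its inverse,
   and n the order of its target: the part of U prime to n lies in ker f, so it is
   normalised by the generators. *)
Lemma envelope_finitely_many_primes :
  exists n : nat, forall x : G, pro_elt (\pi(n))^'%N x -> x = 1.
Proof.
have [|s _ gen] := @envelope_generators setT.
  by move=> g; exists g => //; rewrite mulVg; apply: subgroup1 envelope_subgroup.
have nA : nbhs 1 [set x | {in s, forall t, U (x ^ t) /\ U (x ^ t^-1)}].
  apply: filter_forall_seq => t _.
  by apply: filterI; apply: nbhs_conjg; apply: envelope_open1.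
have pG : profinite G by case: nilG.
have [H [f [nf rf fA]]] := profinite_quotient pG (envelope_preimage nA).
exists #|[set: H]%SET|; set pi := (\pi(_))^'%N.
(* The order of [f x] divides that of [H], and [pi] excludes the primes of the latter. *)
have ker x : pro_elt pi x -> f x = 1.
  move=> /(pro_elt_p_elt nf) p'x; apply/eqP; rewrite -order_eq1; apply/eqP.
  apply: pnat_1 p'x; apply: mem_p_elt (finset.in_setT _).
  exact: pgroup_pi.
have in_eta x : pro_elt pi x -> U x -> (eta @` (@pro_elt G pi)) x.
  by move=> px [y _ yx]; exists y => //; apply/envelope_pro_elt; rewrite yx.
have W1 : @pro_elt G pi = [set 1].
  apply: (envelope_normalized_trivial gen).
  - exact: pro_elt_closed.
  - by split; [apply: pro_elt_subgroup|move=> x y; apply: pro_eltJ].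
  move=> t ts x; split=> -[w pw e].
    have px : pro_elt pi x.
      by rewrite -(conjgK t x) -e; apply/pro_eltJ/envelope_pro_elt.
    apply: in_eta => //; rewrite -(conjgK t x) -e.
    by have [] := fA w (ker w pw) t ts.
  have px : pro_elt pi (x ^ t).
    by rewrite -e; apply/pro_eltJ/envelope_pro_elt.
  apply: in_eta => //; rewrite -e.
  by have [] := fA w (ker w pw) t ts.
by move=> x; rewrite W1.
Qed.

(* The elements of L centralising all pro-pi elements near 1 form a normal
   subgroup containing the pro-pi' part of U. If it is dense, then L is
   generated by U and finitely many of its elements, and these normalise the
   pro-pi part of a small open normal subgroup of U. *)
Lemma envelope_pro_elt_alternative pi :
  (forall x : G, pro_elt pi^'%N x -> x = 1) \/
  nbhs 1 [set x : G | pro_elt pi x -> x = 1].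
Proof.
pose N := [set g : L | nbhs 1 [set x | pro_elt pi x -> commute g x]].
have nN : normal_subgroup N.
  split; first split=> [|g h Ng Nh|g Ng].
  - by apply: filterS filterT => x _ _; apply/commute_sym/commute1.
  - apply: filterS2 Ng Nh => x gx hx px; apply/commute_sym/commuteM;
      apply/commute_sym; [exact: gx|exact: hx].
  - by apply: filterS Ng => x gx px; apply/commute_sym/commuteV/commute_sym/gx.
  move=> g h Ng; have := nbhs_conjg h^-1 Ng.
  apply: filterS => x /= gx px.
  by rewrite -(conjgKV h x) /commute -!conjMg (gx (pro_eltJ _ px)).
have [clN1|clNT] := simpleL.2 _ (@closed_closure L N) (closure_normal_subgroup nN).
  left=> x px; apply: envelope_inj; rewrite multiplicative1.
  (* The pro-pi elements of [U] all commute with the image of [x], so this image is already in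
     [N]. *)
  suff : closure N (eta x) by rewrite clN1.
  apply: subset_closure; apply: filterS envelope_open1 => _ [y _ <-].
  move=> /envelope_pro_elt py; apply/gmulf_commute/commute_sym.
  exact: pro_elt_commute py px.
right.
have [|s sN gen] := @envelope_generators N.
  move=> g; have : closure N g by rewrite clNT.
  case/(_ [set t | U (g^-1 * t)] (nbhs_translate g envelope_open1)) => t [Nt Ut].
  exists t => //; rewrite -[t^-1 * g]invgK invMg invgK.
  exact: subgroupV envelope_subgroup _ Ut.
(* On one common neighbourhood of 1, every generator in [s] commutes with all pro-pi elements, so
   conjugation by it fixes the set used for [W1] pointwise. *)
have nA := filter_forall_seq (nbhs_filter (1 : L)) sN.
have pG : profinite G by case: nilG.
have [H [f [nf rf fA]]] := profinite_quotient pG (envelope_preimage nA).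
have [[kM kJ] kC] := (kernel_normal f, kernel_closed nf).
have sp := pro_elt_subgroup nilG pi.
have W1 : [set x | f x = 1] `&` @pro_elt G pi = [set 1].
  apply: (envelope_normalized_trivial gen).
  - by apply: closedI => //; apply: pro_elt_closed.
  - split; last by move=> x y [fx px]; split; [apply: kJ|apply: pro_eltJ].
    split=> [|x y [fx px] [fy py]|x [fx px]].
    + by split; [exact: multiplicative1|exact: subgroup1 sp].
    + by split; [exact: subgroupM kM _ _ fx fy|exact: subgroupM sp _ _ px py].
    + by split; [exact: subgroupV kM _ fx|exact: subgroupV sp _ px].
  move=> t ts x.
  have tJ y : (eta @` ([set x | f x = 1] `&` @pro_elt G pi)) y -> y ^ t = y.
    move=> [w [fw pw] <-]; have := fA w fw t ts; rewrite /=.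
    move=> /(_ (iffRL (envelope_pro_elt _ _) pw)) c.
    by rewrite conjgE -c mulKg.
  split=> Wx; last by rewrite tJ.
  suff -> : x = x ^ t by [].
  by apply: (can_inj (conjgK t)); rewrite (tJ _ Wx).
by apply: filterS nf => x fx px; have : [set 1] x by rewrite -W1.
Qed.

Lemma envelope_pro_p : exists2 p : nat, prime p & pro_p p G.
Proof.
have [n pi1] := envelope_finitely_many_primes.
apply: contrapT => no_p.
(* Since [G] is pro-p for no prime, the second alternative holds for each prime divisor of [n]. *)
have nA : nbhs 1 [set x : G | {in primes n, forall p : nat, pro_elt p x -> x = 1}].
  apply: filter_forall_seq => p pn; have [|//] := envelope_pro_elt_alternative p.
  move=> p'1; case: no_p; exists p; last exact: pro_p_trivial_complement.
  by move: pn; rewrite mem_primes => /andP[].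
have pG : profinite G by case: nilG.
have [H [f [nf rf fA]]] := profinite_quotient pG nA.
have [x fx x1] := infinite_kernel f infG.
(* For [q] dividing [n], the pro-q part of [x] lies in the kernel of [f] and is trivial, so [q]
   cannot divide the order of [g x]. *)
apply: x1; apply: pi1; apply: pro_eltP => // K g ng rg.
apply/pnatP; first exact: order_gt0.
move=> q pq qx; apply/negP => qn.
have [a [b [xba pa p'b fa]]] := pro_elt_decomposition nilG q x.
have a1 : a = 1 by apply: (fA a (fa H f nf fx) q qn pa).
move: xba; rewrite a1 mulg1 => xb; rewrite -xb in p'b.
have /pnatP := pro_elt_p_elt ng p'b.
by move=> /(_ (order_gt0 _) q pq qx); rewrite inE /= inE eqxx.
Qed.

End Envelope.

Theorem corollary4p10 (G : topologicalGroupType)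
    (G_pro_nilpotent : pro_nilpotent G)
    (G_infinite : infinite_set [set: G])
    (G_envelope : exists (L : topologicalGroupType)
                         (eta : {multiplicative G -> L}),
        [/\ envelope eta, compactly_generated L & topologically_simple L]) :
  exists2 p : nat, prime p & pro_p p G.
Proof.
have [L [eta [env cgL simpleL]]] := G_envelope.
exact: envelope_pro_p env G_pro_nilpotent G_infinite cgL simpleL.
Qed.
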